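(* Every Boolean control network that is Type-1 observable is also Type-2 observable. The converse is not true: there exists a Boolean control network that is Type-2 observable but not Type-1 observable.
   Context: A Boolean control network (BCN, in algebraic form) is given by positive integers $n,m,q$, with $N=2^n$, $M=2^m$, $Q=2^q$, and a system $x(t+1)=Lu(t)x(t)$, $y(t)=Hx(t)$, $t=0,1,2,\dots$, with states $x(t)\in\Delta_N$, inputs $u(t)\in\Delta_M$, outputs $y(t)\in\Delta_Q$. Here $\Delta_k$ is the set of columns of the identity matrix $I_k$; $L$ is an $N\times NM$ matrix with all columns in $\Delta_N$ and $H$ is a $Q\times N$ matrix with all columns in $\Delta_Q$. Products are semi-tensor products; concretely $Lux=L(u\otimes x)$ for $u\in\Delta_M$, $x\in\Delta_N$, with $\otimes$ the Kronecker product. For $x_0\in\Delta_N$, $p\ge 1$ and $U=u_0\cdots u_{p-1}\in(\Delta_M)^p$, put $x_{t+1}=Lu_tx_t$ for $0\le t<p$ and $(HL)_{x_0}^p(U)=(Hx_1)\cdots(Hx_p)\in(\Delta_Q)^p$. Type-1 observability: for every $x_0\in\Delta_N$ there exist $p\ge1$ and $U\in(\Delta_M)^p$ such that for all $\bar x_0\in\Delta_N$ with $\bar x_0\ne x_0$, $Hx_0=H\bar x_0$ implies $(HL)_{x_0}^p(U)\neq(HL)_{\bar x_0}^p(U)$. Type-2 observability: for any distinct $x_0,\bar x_0\in\Delta_N$ there exist $p\ge1$ and $U\in(\Delta_M)^p$ such that $Hx_0=H\bar x_0$ implies $(HL)_{x_0}^p(U)\neq(HL)_{\bar x_0}^p(U)$.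 *)

(* Defs.v *)
From mathcomp Require Import all_boot all_order all_algebra.
From mathcomp Require Import mxtens.

Set Implicit Arguments.
Unset Strict Implicit.
Unset Printing Implicit Defensive.

Import GRing.Theory.
Local Open Scope ring_scope.

(* All matrices involved have entries 0 and 1; they are taken over int. *)

Definition Delta (k : nat) : {pred 'cV[int]_k} :=
  [pred v | [exists i : 'I_k, v == col i (1%:M : 'M[int]_k)]].
Arguments Delta k : clear implicits.

(* The columns of the transition matrix are indexed by 2 ^ m * 2 ^ n, in this
   order, so that it can be multiplied by the Kronecker product u *t x. *)
Record BCN : Type := MkBCN {
  bcn_n : nat;
  bcn_m : nat;
  bcn_q : nat;
  bcn_n_gt0 : (0 < bcn_n)%N;
  bcn_m_gt0 : (0 < bcn_m)%N;
  bcn_q_gt0 : (0 < bcn_q)%N;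
  bcn_L : 'M[int]_(2 ^ bcn_n, 2 ^ bcn_m * 2 ^ bcn_n);
  bcn_H : 'M[int]_(2 ^ bcn_q, 2 ^ bcn_n);
  bcn_L_col : forall j, col j bcn_L \in Delta (2 ^ bcn_n);
  bcn_H_col : forall j, col j bcn_H \in Delta (2 ^ bcn_q)
}.

(* The semi-tensor product L u x.  The Kronecker product u *t x has 1 * 1
   columns, which is convertible to 1. *)
Definition bcn_step (B : BCN) (x : 'cV[int]_(2 ^ bcn_n B))
    (u : 'cV[int]_(2 ^ bcn_m B)) : 'cV[int]_(2 ^ bcn_n B) :=
  bcn_L B *m (u *t x : 'cV[int]_(2 ^ bcn_m B * 2 ^ bcn_n B)).

Definition bcn_out (B : BCN) (x : 'cV[int]_(2 ^ bcn_n B)) :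
    'cV[int]_(2 ^ bcn_q B) :=
  bcn_H B *m x.

(* scanl lists x_1, ..., x_p, without the initial state x_0. *)
Definition HL (B : BCN) (p : nat) (x0 : 'cV[int]_(2 ^ bcn_n B))
    (U : p.-tuple 'cV[int]_(2 ^ bcn_m B)) : p.-tuple 'cV[int]_(2 ^ bcn_q B) :=
  [tuple of map (@bcn_out B) (scanl (@bcn_step B) x0 U)].

Definition type1_observable (B : BCN) : Prop :=
  forall x0, x0 \in Delta (2 ^ bcn_n B) ->
  exists (p : nat) (U : p.-tuple 'cV[int]_(2 ^ bcn_m B)),
    [/\ (1 <= p)%N,
        {subset U <= Delta (2 ^ bcn_m B)}
      & forall x0', x0' \in Delta (2 ^ bcn_n B) -> x0' <> x0 ->
          bcn_out x0 = bcn_out x0' -> HL x0 U <> HL x0' U].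

Definition type2_observable (B : BCN) : Prop :=
  forall x0 x0', x0 \in Delta (2 ^ bcn_n B) -> x0' \in Delta (2 ^ bcn_n B) ->
  x0 <> x0' ->
  exists (p : nat) (U : p.-tuple 'cV[int]_(2 ^ bcn_m B)),
    [/\ (1 <= p)%N,
        {subset U <= Delta (2 ^ bcn_m B)}
      & bcn_out x0 = bcn_out x0' -> HL x0 U <> HL x0' U].

(* Main.v *)
Require Import Defs.
From mathcomp Require Import all_boot all_order all_algebra.
From mathcomp Require Import mxtens.

(** Type-1 observability asks for one input word that separates [x0] from all
    other states at once, whereas in Type-2 observability the word may depend
    on the other state; so the word given by Type-1 serves every pair.

    For the converse, consider a network in which a state is merged, under each
    input, with some other state of the same output.  Then the first letter of
    any word already defeats that word, whatever follows, and Type-1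
    observability fails ([merging_not_type1]).  Nevertheless one letter may
    suffice to separate each given pair of states ([one_step_type2]).  Four
    states 0, 1, 2, 3 and two inputs 0, 1 are enough: input 0 sends state 1 to
    0 and all others to 3, input 1 sends state 2 to 0 and all others to 3, and
    the output only tells whether the state is 3.  Input 0 merges 0 with 2 but
    separates 1 from both 0 and 2; input 1 merges 0 with 1 but separates 2 from
    both 0 and 1.  Hence no single word separates 0 from both 1 and 2. *)

Set Implicit Arguments.
Unset Strict Implicit.
Unset Printing Implicit Defensive.

Import GRing.Theory.
Local Open Scope ring_scope.

Lemma type1_type2 B : type1_observable B -> type2_observable B.
Proof.
move=> obs1 x0 x0' Dx0 Dx0' neq.
have [p [U [p_gt0 DU sepU]]] := obs1 x0 Dx0.
by exists p, U; split=> //; apply: sepU => // /esym.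
Qed.

(** Only the first letter of a word matters: after the merge both trajectories
    coincide, and outputs are recorded from time 1 on. *)
Lemma merging_not_type1 B x0 :
    x0 \in Delta (2 ^ bcn_n B) ->
    (forall u, u \in Delta (2 ^ bcn_m B) -> exists x0',
      [/\ x0' \in Delta (2 ^ bcn_n B), x0' <> x0, bcn_out x0 = bcn_out x0'
        & bcn_step x0 u = bcn_step x0' u]) ->
  ~ type1_observable B.
Proof.
move=> Dx0 merge /(_ x0 Dx0) [[|p]] [U] [] //= _.
case/tupleP: U => u U DU.
have [|x0' [Dx0' neq eq_out eq_step]] := merge u; first exact/DU/mem_head.
move/(_ x0' Dx0' neq eq_out); apply.
by apply: val_inj; rewrite /= eq_step.
Qed.

Lemma one_step_type2 B :
    (forall x x', x \in Delta (2 ^ bcn_n B) -> x' \in Delta (2 ^ bcn_n B) ->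
      x <> x' -> exists2 u, u \in Delta (2 ^ bcn_m B) &
      bcn_out x = bcn_out x' ->
      bcn_out (bcn_step x u) <> bcn_out (bcn_step x' u)) ->
  type2_observable B.
Proof.
move=> sep x x' Dx Dx' /(sep _ _ Dx Dx') [u Du sepu].
exists 1%N, [tuple u]; split=> // [v|/sepu neq /(congr1 val) [] //].
by rewrite mem_seq1 => /eqP->.
Qed.

Lemma DeltaP k (v : 'cV_k) :
  reflect (exists i, v = delta_mx i 0) (v \in Delta k).
Proof.
by apply: (iffP existsP) => -[i Dv]; exists i; move: Dv; rewrite col1 => /eqP.
Qed.

Lemma mem_delta k (i : 'I_k) : delta_mx i 0 \in Delta k.
Proof. by apply/DeltaP; exists i. Qed.

Lemma delta_inj k : injective (fun i : 'I_k => delta_mx i 0 : 'cV[int]_k).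
Proof.
move=> i j /matrixP/(_ i 0); rewrite !mxE !eqxx /= andbT.
by case: eqP.
Qed.

Definition fun_mx k l (f : 'I_k -> 'I_l) : 'M[int]_(l, k) :=
  \matrix_(i, j) (i == f j)%:R.

Lemma fun_mx_delta k l (f : 'I_k -> 'I_l) j :
  fun_mx f *m delta_mx j 0 = delta_mx (f j) (0 : 'I_1).
Proof. by rewrite -colE; apply/matrixP=> i z; rewrite !mxE ord1 andbT. Qed.

Lemma col_fun_mx k l (f : 'I_k -> 'I_l) j : col j (fun_mx f) \in Delta l.
Proof. by rewrite colE fun_mx_delta mem_delta. Qed.

Lemma tens_delta k l (i : 'I_k) (j : 'I_l) :
  (delta_mx i 0 : 'cV[int]_k) *t (delta_mx j 0 : 'cV[int]_l) =
  delta_mx (mxtens_index (i, j)) (0 : 'I_1).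
Proof.
apply/matrixP=> s z; rewrite (ord1 z); case: (mxtens_indexP s) => i' j'.
rewrite !mxE mxtens_indexK (can_eq (@mxtens_indexK _ _)) xpair_eqE /=.
by rewrite !ord1 !andbT -natrM mulnb.
Qed.

Section FunctionNetwork.

Variables (n m q : nat) (n_gt0 : (0 < n)%N) (m_gt0 : (0 < m)%N).
Variable (q_gt0 : (0 < q)%N).
Variables (f : 'I_(2 ^ m) -> 'I_(2 ^ n) -> 'I_(2 ^ n)).
Variable (h : 'I_(2 ^ n) -> 'I_(2 ^ q)).

(** The Kronecker product of an input and a state is the basis vector whose
    index encodes the pair of their indices, so the column of the transition
    matrix at this index holds the next state. *)
Definition fun_bcn : BCN :=
  MkBCN n_gt0 m_gt0 q_gt0
    (col_fun_mx (fun s => let ux := mxtens_unindex s in f ux.1 ux.2))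
    (col_fun_mx h).

Lemma fun_bcn_step (x : 'I_(2 ^ n)) (u : 'I_(2 ^ m)) :
  @bcn_step fun_bcn (delta_mx x 0) (delta_mx u 0) = delta_mx (f u x) 0.
Proof. by rewrite /bcn_step tens_delta fun_mx_delta mxtens_indexK. Qed.

Lemma fun_bcn_out (x : 'I_(2 ^ n)) :
  @bcn_out fun_bcn (delta_mx x 0) = delta_mx (h x) 0.
Proof. exact: fun_mx_delta. Qed.

End FunctionNetwork.

Definition ex_state (k : nat) : 'I_(2 ^ 2) := @inord 3 k.

Definition ex_step (u : 'I_(2 ^ 1)) (x : 'I_(2 ^ 2)) : 'I_(2 ^ 2) :=
  if x == u.+1 :> nat then ex_state 0 else ex_state 3.

Definition ex_out (x : 'I_(2 ^ 2)) : 'I_(2 ^ 1) :=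
  @inord 1 (x == 3 :> nat).

Definition ex_bcn : BCN := @fun_bcn 2 1 1 isT isT isT ex_step ex_out.

Lemma val_ex_state k : (k < 4)%N -> ex_state k = k :> nat.
Proof. exact: inordK. Qed.

Lemma ex_outE x x' :
  (ex_out x == ex_out x') = ((x == 3 :> nat) == (x' == 3 :> nat)).
Proof.
rewrite /ex_out -val_eqE.
by case: (x == 3 :> nat); case: (x' == 3 :> nat); rewrite /= !inordK.
Qed.

Lemma ex_type2 : type2_observable ex_bcn.
Proof.
apply: one_step_type2 => _ _ /DeltaP[x ->] /DeltaP[x' ->] neq.
have {neq} neq : x <> x' :> nat by move=> /val_inj eqx; case: neq; rewrite eqx.
(* Input 0 singles out state 1 and input 1 singles out state 2. *)
pose u : 'I_(2 ^ 1) := @inord 1 (~~ ((x == 1 :> nat) || (x' == 1 :> nat))).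
exists (delta_mx u 0); first exact: mem_delta.
rewrite !fun_bcn_step !fun_bcn_out => /delta_inj/eqP eq_out.
move=> /delta_inj/eqP; move: eq_out; rewrite !ex_outE /ex_step /u.
rewrite !inordK; last by case: (~~ _).
case: x x' neq {u} => [[|[|[|[|?]]]] ?] [[|[|[|[|?]]]] ?] //= neq;
  by rewrite ?val_ex_state.
Qed.

Lemma ex_not_type1 : ~ type1_observable ex_bcn.
Proof.
apply: (@merging_not_type1 ex_bcn (delta_mx (ex_state 0) 0)).
  exact: mem_delta.
move=> _ /DeltaP[u ->].
(* Input 0 merges state 0 with state 2, and input 1 merges it with state 1. *)
have ltu : (2 - u < 4)%N by apply: leq_ltn_trans (leq_subr _ _) _.
exists (delta_mx (ex_state (2 - u)) 0); split; first exact: mem_delta.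
- move=> /delta_inj /(congr1 val) /=; rewrite !inordK //.
  by case: u {ltu} => [[|[|?]] ?].
- rewrite !fun_bcn_out; congr delta_mx; apply/eqP; rewrite ex_outE.
  by rewrite !val_ex_state //; case: u {ltu} => [[|[|?]] ?].
- rewrite !fun_bcn_step /ex_step !val_ex_state //.
  by case: u {ltu} => [[|[|?]] ?].
Qed.

Theorem mainTheorem9 :
  (forall B : BCN, type1_observable B -> type2_observable B) /\
  (exists B : BCN, type2_observable B /\ ~ type1_observable B).
Proof.
split; first exact: type1_type2.
exists ex_bcn; split; [exact: ex_type2 | exact: ex_not_type1].
Qed.
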